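(* Let $(\phi,\mu)$ be a periodic solution on $\Omega$ of $$\partial_t\phi=\operatorname{div}\big(b(\phi)\nabla\mu\big),\qquad \mu=-\gamma\Delta\phi+f(\phi)$$ for the parameters $(\gamma,b,f)$. Then for any $c\in\mathbb{R}$ and any scalar $d>0$, the pair $(\hat\phi,\hat\mu)=(\phi,\ \mu/d+c)$ is a solution of $$\partial_t\hat\phi=\operatorname{div}\big(\hat b(\hat\phi)\nabla\hat\mu\big),\qquad \hat\mu=-\hat\gamma\Delta\hat\phi+\hat f(\hat\phi)$$ for the parameters $$\hat\gamma=\gamma/d,\qquad \hat b(s)=d\cdot b(s),\qquad \hat f(s)=f(s)/d+c .$$
   Context: $\Omega$ is the $n$-dimensional torus, $n\in\{1,2,3\}$, and all functions on $\Omega$ are periodic. $\gamma>0$ is a constant (interface parameter), $b:\mathbb{R}\to\mathbb{R}_+$ is the mobility function, $f:\mathbb{R}\to\mathbb{R}$ is the derivative $f=F'$ of a potential $F$, $\phi$ is the phase fraction and $\mu$ the chemical potential, both functions of $(x,t)\in\Omega\times[0,T]$. The system is the Cahn-Hilliard system. *)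

(* Defs.v *)
From mathcomp Require Import all_boot all_order all_algebra.
From mathcomp Require Import all_classical all_reals all_analysis.
Import Order.TTheory GRing.Theory Num.Theory.
Import numFieldNormedType.Exports.

Set Implicit Arguments.
Unset Strict Implicit.
Unset Printing Implicit Defensive.

Local Open Scope classical_set_scope.
Local Open Scope ring_scope.

(* A function on the torus (R/LZ)^n depending on time is a map u x t on R^n x R
   that is L-periodic in each coordinate of x; its values for t outside
   [0, T] are irrelevant. *)

Section Operators.
Context {R : realType} {n : nat}.
Implicit Types (u : 'rV[R]_n -> R -> R) (v : 'rV[R]_n -> R -> 'rV[R]_n).

Definition torus_periodic (L T : R) u : Prop :=
  forall (i : 'I_n) (x : 'rV[R]_n) (t : R), 0 <= t <= T -> u (x + L *: 'e_i) t = u x t.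

Definition dt u : 'rV[R]_n -> R -> R := fun x t => derive1 (u x) t.

Definition dx (i : 'I_n) u : 'rV[R]_n -> R -> R :=
  fun x t => 'D_('e_i) (u ^~ t) x.

Definition grad u : 'rV[R]_n -> R -> 'rV[R]_n :=
  fun x t => \row_i dx i u x t.

Definition divergence v : 'rV[R]_n -> R -> R :=
  fun x t => \sum_i dx i (fun y s => v y s 0 i) x t.

Definition laplacian u : 'rV[R]_n -> R -> R := divergence (grad u).

(* Joint continuity in (x, t), for t restricted to I. *)
Definition continuous_on_times (I : set R) u : Prop :=
  {within [set p : 'rV[R]_n * R | I p.2],
    continuous (fun p : 'rV[R]_n * R => u p.1 p.2)}.

Definition C1_time (T : R) u : Prop :=
  (forall (x : 'rV[R]_n) (t : R), 0 < t < T -> derivable (u x) t 1) /\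
  continuous_on_times `]0, T[ (dt u).

Definition C1_space (T : R) u : Prop :=
  forall i : 'I_n,
    (forall (x : 'rV[R]_n) (t : R), 0 < t < T -> derivable (u ^~ t) x 'e_i) /\
    continuous_on_times `]0, T[ (dx i u).

End Operators.

Section CahnHilliard.
Context {R : realType}.

(* Here R_+ = [0, +oo[, so degenerate mobilities are allowed. *)
Definition CH_parameters (gamma : R) (b f : R -> R) : Prop :=
  [/\ 0 < gamma,
      forall s, 0 <= b s
    & exists F : R -> R, forall s : R, is_derive s (1 : R) F (f s)].

Definition CH_flux n (b : R -> R) (phi mu : 'rV[R]_n -> R -> R) :
    'rV[R]_n -> R -> 'rV[R]_n :=
  fun x t => b (phi x t) *: grad mu x t.

(* Classical solutions. As b need not be differentiable, C^1 regularity is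
   required of the flux itself rather than second derivatives of mu. *)
Record CH_solution n (L T gamma : R) (b f : R -> R)
    (phi mu : 'rV[R]_n -> R -> R) : Prop := {
  phi_periodic : torus_periodic L T phi;
  mu_periodic : torus_periodic L T mu;
  phi_continuous : continuous_on_times `[0, T] phi;
  mu_continuous : continuous_on_times `[0, T] mu;
  phi_C1_time : C1_time T phi;
  phi_C1_space : C1_space T phi;
  phi_C2_space : forall i, C1_space T (dx i phi);
  mu_C1_space : C1_space T mu;
  flux_C1_space : forall i,
    C1_space T (fun x t => CH_flux b phi mu x t 0 i);
  phi_equation : forall (x : 'rV[R]_n) (t : R), 0 < t < T ->
    dt phi x t = divergence (CH_flux b phi mu) x t;
  mu_equation : forall (x : 'rV[R]_n) (t : R), 0 < t < T ->
    mu x t = - gamma * laplacian phi x t + f (phi x t)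
}.

End CahnHilliard.

(* Main.v *)
Require Import Defs.
From mathcomp Require Import all_boot all_order all_algebra.
From mathcomp Require Import all_classical all_reals all_analysis.
Import Order.TTheory GRing.Theory Num.Theory.
Import numFieldNormedType.Exports.

Local Open Scope classical_set_scope.
Local Open Scope ring_scope.

(** Replacing [mu] by [mu / d + c] divides its spatial gradient by [d], the
    additive constant being killed by differentiation. Multiplying the mobility
    by [d] undoes this division, so that the flux [b(phi) grad mu], and with it
    the evolution equation and the regularity required of the flux, does not
    change at all ([CH_flux_rescale]). The equation for the chemical potential
    is itself affine in [mu], [gamma] and [f], hence is preserved when it is
    divided by [d] and shifted by [c]; the potential of the new [f] is
    [F / d + c id].

    The gradient is computed from the derivability of [mu], which a solution
    has only at times [0 < t < T]. The two fluxes are therefore identified at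
    these times only, and regularity is transported along identities of this
    restricted kind ([C1_space_eq]). *)

Section Operators.
Context {R : realType} {n : nat}.
Implicit Types u v phi mu : 'rV[R]_n -> R -> R.

Lemma dx_eq i u v x t : (forall y, u y t = v y t) -> dx i u x t = dx i v x t.
Proof. by move=> uv; rewrite /dx; congr derive; apply/funext => y; exact: uv. Qed.

Lemma derivable_affine (f : 'rV[R]_n -> R) x e (k c : R) :
  derivable f x e -> derivable (fun y => f y / k + c) x e.
Proof.
move=> df; apply: (@derivableD _ _ _ (fun y => f y / k) (cst c)) => //.
exact: (@derivableM _ _ f (cst k^-1)).
Qed.

Lemma derive_affine (f : 'rV[R]_n -> R) x e (k c : R) :
  derivable f x e -> 'D_e (fun y => f y / k + c) x = 'D_e f x / k.
Proof.
move=> df.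
rewrite (@deriveD _ _ _ (fun y => f y / k) (cst c)) //; last first.
  exact: (@derivableM _ _ f (cst k^-1)).
rewrite derive_cst addr0 (@deriveM _ _ f (cst k^-1)) // derive_cst.
by rewrite scaler0 add0r /GRing.scale /= mulrC.
Qed.

Lemma continuous_on_times_eq (I : set R) u v :
  (forall x t, I t -> u x t = v x t) ->
  continuous_on_times I u -> continuous_on_times I v.
Proof.
move=> uv; apply: subspace_eq_continuous => -[x t]; rewrite inE /= => It.
exact: uv.
Qed.

Lemma continuous_on_times_affine (I : set R) u (k c : R) :
  continuous_on_times I u ->
  continuous_on_times I (fun x t => u x t / k + c).
Proof.
move=> cu p; apply: cvgD; last exact: cvg_cst.
by apply: cvgM; [exact: cu|exact: cvg_cst].
Qed.

(** The spatial derivatives at time [t] depend on [u] at time [t] only, so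
    agreement at the times of the open interval suffices. *)
Lemma C1_space_eq (T : R) u v :
  (forall x t, 0 < t < T -> u x t = v x t) -> C1_space T u -> C1_space T v.
Proof.
move=> uv uC1 i; have [du cdu] := uC1 i; split=> [x t tT|].
  rewrite (_ : v ^~ t = u ^~ t); first exact: du.
  by apply/funext => y; rewrite uv.
apply: continuous_on_times_eq cdu => x t /=; rewrite in_itv /= => tT.
by apply: dx_eq => y; exact: uv.
Qed.

Lemma dx_affine (T : R) u (k c : R) i x t : C1_space T u -> 0 < t < T ->
  dx i (fun x t => u x t / k + c) x t = dx i u x t / k.
Proof. by move=> uC1 tT; apply: derive_affine; exact: (uC1 i).1. Qed.

Lemma C1_space_affine (T : R) u (k c : R) :
  C1_space T u -> C1_space T (fun x t => u x t / k + c).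
Proof.
move=> uC1 i; have [du cdu] := uC1 i; split=> [x t tT|].
  by apply: derivable_affine; exact: du.
apply: (continuous_on_times_eq _ (fun x t => dx i u x t / k + 0)); last first.
  exact: continuous_on_times_affine.
by move=> x t /=; rewrite in_itv /= addr0 => tT; rewrite (dx_affine T).
Qed.

(** The two fluxes are compared at interior times only: elsewhere [mu] need not
    be derivable, and its gradient is then a junk value. *)
Lemma CH_flux_rescale (T c d : R) (b : R -> R) phi mu x t :
  d != 0 -> C1_space T mu -> 0 < t < T ->
  CH_flux (fun s => d * b s) phi (fun x t => mu x t / d + c) x t =
  CH_flux b phi mu x t.
Proof.
move=> d0 muC1 tT; apply/rowP => i; rewrite !mxE (dx_affine T) //.
by rewrite mulrACA mulrC mulrA mulrVK ?unitfE // mulrC.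
Qed.

End Operators.

Lemma CH_parameters_rescale (R : realType) (gamma c d : R) (b f : R -> R) :
  0 < d -> CH_parameters gamma b f ->
  CH_parameters (gamma / d) (fun s => d * b s) (fun s => f s / d + c).
Proof.
move=> d0 [gamma0 b0 [F dF]]; split; first exact: divr_gt0.
  by move=> s; rewrite mulr_ge0 // ltW.
exists (d^-1 *: F + c *: id) => s.
have := is_deriveD (is_deriveZ d^-1 (dF s)) (is_deriveZ c (is_derive_id s 1)).
by rewrite /GRing.scale /= mulr1 mulrC.
Qed.

Theorem lemma3 (R : realType) (n : nat) (hn : (1 <= n <= 3)%N)
    (L T : R) (hL : 0 < L) (hT : 0 < T)
    (gamma : R) (b f : R -> R) (hpar : CH_parameters gamma b f)
    (phi mu : 'rV[R]_n -> R -> R)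
    (hsol : CH_solution L T gamma b f phi mu)
    (c d : R) (hd : 0 < d) :
  CH_parameters (gamma / d) (fun s => d * b s) (fun s => f s / d + c) /\
  CH_solution L T (gamma / d) (fun s => d * b s) (fun s => f s / d + c)
    phi (fun x t => mu x t / d + c).
Proof.
split; first exact: CH_parameters_rescale.
have d0 : d != 0 by rewrite gt_eqF.
have [phiL muL phi0 mu0 phit phi1 phi2 mu1 flux1 phiE muE] := hsol.
have fluxE := fun x t => CH_flux_rescale T c d b phi mu x t d0 mu1.
split.
- exact: phiL.
- by move=> i x t tT; rewrite muL.
- exact: phi0.
- exact: continuous_on_times_affine.
- exact: phit.
- exact: phi1.
- exact: phi2.
- exact: C1_space_affine.
- by move=> i; apply: C1_space_eq (flux1 i) => x t tT; rewrite fluxE.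
- move=> x t tT; rewrite (phiE x t tT) /divergence.
  by apply: eq_bigr => i _; apply: dx_eq => y; rewrite fluxE.
- by move=> x t tT; rewrite (muE x t tT) mulrDl -addrA -mulNr mulrAC addrA.
Qed.
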